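(* Let $G=(S,\mathcal{F})$ be a local forest greedoid with $S\neq\emptyset$ and rank function $r$, and let $d,c\in\mathbb{R}^S$ with $d(s)>0$ for all $s\in S$. Then the value of the Local Forest Greedoid Base Game on the input $(G,d,c)$ is $$\max_{\emptyset\ne U\subseteq S}\frac{r(S)-r(S-U)-q(U)}{p(U)},$$ where $p(s)=\frac{1}{d(s)}$ and $q(s)=\frac{c(s)}{d(s)}$ for all $s\in S$.
   Context: Notation: $X+x=X\cup\{x\}$, $X-x=X\setminus\{x\}$, $X-Y=X\setminus Y$; for a function $p:S\to\mathbb{R}$ and $U\subseteq S$, $p(U)=\sum_{s\in U}p(s)$. A greedoid $G=(S,\mathcal{F})$ consists of a finite ground set $S$ and a family $\mathcal{F}\subseteq 2^S$ (the feasible sets) such that $\emptyset\in\mathcal{F}$, and whenever $X,Y\in\mathcal{F}$ with $|X|<|Y|$ there is $y\in Y-X$ with $X+y\in\mathcal{F}$. The rank of $A\subseteq S$ is $r(A)=\max\{|X| : X\subseteq A, X\in\mathcal{F}\}$. A base of $G$ is a feasible set of maximum size. $\mathcal{F}^{\vee}$ denotes the family of subfeasible sets, i.e. subsets of feasible sets. $G$ is a local forest greedoid if all of the following hold: - Local Union Property: if $A,B\in\mathcal{F}$ and $A\cup B\in\mathcal{F}^{\vee}$ then $A\cup B\in\mathcal{F}$; - Local Intersection Property: if $A,B\in\mathcal{F}$ and $A\cup B\in\mathcal{F}^{\vee}$ then $A\cap B\in\mathcal{F}$; - Local Forest Property: if $A, A+x, A+y, A\cup\{x,y\}, A\cup\{x,y,z\}\in\mathcal{F}$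 then $A\cup\{x,z\}\in\mathcal{F}$ or $A\cup\{y,z\}\in\mathcal{F}$. For $A\in\mathcal{F}$ and $x\in S$, the shadow of $x$ on $A$ is $sh_A(x)=|A|-r(A-x)$. The Local Forest Greedoid Base Game on input $(G,d,c)$ is the following two-player zero-sum game: the Attacker chooses an element $s\in S$, the Defender (simultaneously) chooses a base $B$ of $G$, and the payoff from the Defender to the Attacker is $d(s)\cdot sh_B(s)-c(s)$. The game value is the (unique) Nash-equilibrium expected payoff to the Attacker in mixed strategies, i.e. the minimum over probability distributions $\delta$ on the set of bases of $\max_{s\in S}\sum_B\delta(B)\,(d(s)\,sh_B(s)-c(s))$ (equivalently, by von Neumann's minimax theorem, the corresponding max-min over the Attacker's mixed strategies). *)

(* Defs.v *)
(* MathComp world; the real numbers are any [R : realType]. *)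
From HB Require Import structures.
From mathcomp Require Import all_boot all_order all_algebra.
From mathcomp Require Import reals.

Set Implicit Arguments.
Unset Strict Implicit.
Unset Printing Implicit Defensive.

Import Order.TTheory GRing.Theory Num.Theory.
Local Open Scope ring_scope.

Record greedoid (S : finType) := Greedoid {
  feasible :> {set {set S}};
  feasible0 : set0 \in feasible;
  feasible_aug : forall X Y : {set S}, X \in feasible -> Y \in feasible ->
    (#|X| < #|Y|)%N -> exists2 y, y \in Y :\: X & y |: X \in feasible
}.

Section Greedoid.
Variables (S : finType) (G : greedoid S).
Implicit Types (A B X : {set S}) (x y z : S).

Definition rank A : nat := \max_(X in G | X \subset A) #|X|.

Definition is_base B : bool := (B \in G) && [forall X in G, #|X| <= #|B|]%N.

Definition subfeasible A : bool := [exists X in G, A \subset X].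

Definition local_union : Prop := forall A B,
  A \in G -> B \in G -> subfeasible (A :|: B) -> A :|: B \in G.

Definition local_intersection : Prop := forall A B,
  A \in G -> B \in G -> subfeasible (A :|: B) -> A :&: B \in G.

Definition local_forest : Prop := forall A x y z,
  A \in G -> x |: A \in G -> y |: A \in G ->
  A :|: [set x; y] \in G -> A :|: [set x; y; z] \in G ->
  A :|: [set x; z] \in G \/ A :|: [set y; z] \in G.

Definition local_forest_greedoid : Prop :=
  [/\ local_union, local_intersection & local_forest].

(* The truncated subtraction is exact: rank (A :\ x) <= #|A|. *)
Definition shadow A x : nat := (#|A| - rank (A :\ x))%N.

End Greedoid.

(* Finite two-player zero-sum games: the first player (pure strategies I)
   receives u i j from the second player (pure strategies J). *)
Section ZeroSumGame.
Variables (R : realType) (I J : finType) (u : I -> J -> R).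

Definition is_distribution (T : finType) (mu : {ffun T -> R}) : Prop :=
  (forall t, 0 <= mu t) /\ \sum_t mu t = 1.

Definition expected_payoff (sigma : {ffun I -> R}) (delta : {ffun J -> R}) : R :=
  \sum_i \sum_j sigma i * delta j * u i j.

Definition nash_equilibrium (sigma : {ffun I -> R}) (delta : {ffun J -> R}) : Prop :=
  [/\ is_distribution sigma, is_distribution delta,
      forall sigma', is_distribution sigma' ->
        expected_payoff sigma' delta <= expected_payoff sigma delta
    & forall delta', is_distribution delta' ->
        expected_payoff sigma delta <= expected_payoff sigma delta'].

Definition is_game_value (v : R) : Prop :=
  (exists sigma delta,
     nash_equilibrium sigma delta /\ expected_payoff sigma delta = v)
  /\ (forall sigma delta,
     nash_equilibrium sigma delta -> expected_payoff sigma delta = v).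

(* The game value is the minimum over delta of the maximum over i of
   \sum_j delta j * u i j. *)
Lemma game_value_minmax (v : R) : is_game_value v ->
  (exists2 delta : {ffun J -> R}, is_distribution delta &
     forall i, \sum_j delta j * u i j <= v)
  /\ (forall delta : {ffun J -> R}, is_distribution delta ->
     exists i, v <= \sum_j delta j * u i j).
Proof.
case=> -[sigma [delta [[ds dd maxs mind] <-]]] _; split.
  exists delta => // i.
  pose e : {ffun I -> R} := [ffun k => (k == i)%:R].
  have de : is_distribution e.
    split=> [t|]; first by rewrite ffunE ler0n.
    rewrite (bigD1 i) //= big1 ?ffunE ?eqxx ?addr0 // => k /negPf ki.
    by rewrite ffunE ki.
  have := maxs _ de; suff -> : expected_payoff e delta = \sum_j delta j * u i j by [].
  rewrite /expected_payoff (bigD1 i) //= [X in _ + X]big1 ?addr0.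
    by apply: eq_bigr => j _; rewrite ffunE eqxx mul1r.
  by move=> k /negPf ki; rewrite big1 // => j _; rewrite ffunE ki !mul0r.
move=> delta' dd'.
set w := expected_payoff sigma delta.
have [/existsP //|/existsPn small] :=
  boolP [exists i, w <= \sum_j delta' j * u i j].
have := mind _ dd'; rewrite leNgt => /negP[].
have -> : expected_payoff sigma delta' =
          \sum_i sigma i * \sum_j delta' j * u i j.
  apply: eq_bigr => i _; rewrite mulr_sumr.
  by apply: eq_bigr => j _; rewrite mulrA.
rewrite -/w -[w]mul1r -ds.2 mulr_suml.
have [i si] : exists i, 0 < sigma i.
  apply/existsP; apply: contraT => /existsPn s0.
  have := ds.2; rewrite big1 => [/eqP|i _]; first by rewrite eq_sym oner_eq0.
  by apply/eqP; rewrite eq_le ds.1 andbT leNgt s0.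
rewrite (bigD1 i) //= [ltRHS](bigD1 i) //=; apply: ltr_leD.
  by rewrite ltr_pM2l // ltNge small.
apply: ler_sum => k _; apply: ler_wpM2l; first exact: ds.1.
by rewrite ltW // ltNge small.
Qed.

End ZeroSumGame.

Definition lfg_payoff (R : realType) (S : finType) (G : greedoid S)
    (d c : S -> R) (s : S) (B : {B : {set S} | is_base G B}) : R :=
  d s * (shadow G (val B) s)%:R - c s.

Arguments lfg_payoff {R S} G d c s B.

(* Main.v *)
Require Import Defs.
From HB Require Import structures.
From mathcomp Require Import all_boot all_order all_algebra.
From mathcomp Require Import reals lra ring.

Set Implicit Arguments.
Unset Strict Implicit.
Unset Printing Implicit Defensive.

Import Order.TTheory GRing.Theory Num.Theory.
Local Open Scope ring_scope.

(* Let v be the maximum. The Attacker secures v by playing s with probability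
   p(s)/p(U) on a maximising set U, because the shadows of the elements of U on a
   base B add up to at least r(S) - r(S - U).

   For the Defender it suffices, by linear duality, to find for each z >= 0 a base
   B with sum_s z(s) sh_B(s) <= sum_s z(s) w(s), where w = q + v p satisfies the
   cut inequalities r(S) - r(S - U) <= w(U). The left side is the total length of
   the paths (least feasible subsets) of the elements of B, so B is built as in
   Dijkstra's algorithm: add at each step the element with the shortest path. The
   sets of elements by which the current feasible set can be extended are cuts;
   weighted by the increase of the distance, they form a dual packing whose load
   on s is at most z(s) and whose total value is the total length of the paths.
   The local forest property makes each path minus its last element empty or again
   a path, which is what bounds the load. *)

(** * Linear duality by Fourier-Motzkin elimination *)

Lemma exists_strict_between (R : realFieldType) (r s : seq R) :
  (forall a b, a \in r -> b \in s -> a < b) ->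
  exists x, {in r, forall a, a < x} /\ {in s, forall b, x < b}.
Proof.
elim: s => [|b s IHs] rs.
  elim: r {rs} => [|a r [x [rx _]]]; first by exists 0.
  exists (Num.max (a + 1) (x + 1)); split=> // k.
  rewrite inE => /predU1P[->|/rx kx]; rewrite lt_max; apply/orP.
    by left; lra.
  by right; lra.
have [a k ar ks|x [rx xs]] := IHs; first by apply: rs; rewrite // inE ks orbT.
(* The default [b - 1] keeps [l] below [b] even when [r] is empty. *)
pose l := \big[Num.max/b - 1]_(a <- r) a.
have lb : l < b.
  rewrite /l big_seq; elim/big_ind: _ => [|u v ub vb|a ar].
  - by lra.
  - by rewrite gt_max ub vb.
  - by apply: rs; rewrite // mem_head.
exists (Num.min x ((l + b) / 2)); split=> [a ar|k].
  rewrite lt_min rx //=.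
  have al : a <= l.
    rewrite /l; elim: r ar {rs IHs rx l lb} => // c r IHr.
    rewrite inE big_cons => /predU1P[->|/IHr ar]; rewrite le_max ?lexx //.
    by rewrite ar orbT.
  by lra.
rewrite inE => /predU1P[->|/xs xk]; rewrite gt_min; last by rewrite xk.
by apply/orP; right; lra.
Qed.

(* Fourier-Motzkin elimination of the coordinates in [es], one at a time. *)
Lemma cone_alternative (R : realFieldType) (S : finType) (es : seq S)
    (K : {ffun S -> R} -> Prop) (vs : seq {ffun S -> R}) :
  uniq es ->
  (forall a b u v, 0 < a -> 0 < b -> K u -> K v ->
     K [ffun i => a * u i + b * v i]) ->
  (forall v, v \in vs -> K v) ->
  (exists v, K v /\ {in es, forall i, v i <= 0}) \/
  (exists y : S -> R, (forall i, 0 <= y i) /\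
     {in vs, forall v : {ffun S -> R}, 0 < \sum_(i <- es) y i * v i}).
Proof.
elim: es K vs => [|i es IHes] K vs.
  case: vs => [|v vs] _ _ Kvs; last first.
    by left; exists v; split=> //; apply: Kvs; exact: mem_head.
  by right; exists (fun=> 0); split.
move=> /= /andP[ies ues] Kcone Kvs.
(* For [v] in [pos] and [w] in [neg] this is a positive combination whose coordinate [i] cancels. *)
pose comb (v w : {ffun S -> R}) := [ffun k => (- w i) * v k + v i * w k].
pose pos := [seq v : {ffun S -> R} <- vs | 0 < v i].
pose neg := [seq v : {ffun S -> R} <- vs | v i < 0].
pose nonpos := [seq v : {ffun S -> R} <- vs | v i <= 0].
pose K' v := K v /\ v i <= 0.
have [||[v [[Kv vi] ve]]|[y [y0 ypos]]] :=
  IHes K' (nonpos ++ [seq comb v w | v <- pos, w <- neg]) ues.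
- move=> a b u v a0 b0 [Ku ui] [Kv vi]; split; first exact: Kcone.
  by rewrite ffunE; nra.
- move=> v; rewrite mem_cat mem_filter => /orP[/andP[vi /Kvs Kv]|] //.
  case/allpairsP=> -[u w] /= [].
  rewrite !mem_filter => /andP[ui /Kvs Ku] /andP[wi /Kvs Kw] ->; split.
    by apply: Kcone => //; lra.
  by rewrite ffunE; nra.
- by left; exists v; split=> // k; rewrite inE => /predU1P[->|/ve].
right; pose s (u : {ffun S -> R}) := \sum_(k <- es) y k * u k.
(* The multiplier [t] of coordinate [i] must lie above the bounds from [pos] and below those from
   [neg]; these are compatible because [s (comb u w)] is positive. *)
have [a b|t [lt gt]] := @exists_strict_between R
   (0 :: [seq - s u / u i | u : {ffun S -> R} <- pos])
   [seq s w / - w i | w : {ffun S -> R} <- neg].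
  move=> ra /mapP[w]; rewrite mem_filter => /andP[wi wvs] ->.
  move: ra; rewrite inE => /predU1P[->|/mapP[u]].
    rewrite divr_gt0 ?oppr_gt0 //; apply: ypos.
    by rewrite mem_cat mem_filter (ltW wi) wvs.
  rewrite mem_filter => /andP[ui uvs] ->.
  have : 0 < s (comb u w).
    apply: ypos; rewrite mem_cat; apply/orP; right; apply/allpairsP.
    by exists (u, w); rewrite !mem_filter ui wi uvs wvs.
  have -> : s (comb u w) = - w i * s u + u i * s w.
    rewrite /s !mulr_sumr -big_split; apply: eq_bigr => k _ /=.
    by rewrite ffunE; ring.
  by rewrite ltr_pdivrMr // mulrAC ltr_pdivlMr ?oppr_gt0 //; lra.
have t0 : 0 < t by apply: lt; exact: mem_head.
exists (fun k => if k == i then t else y k); split=> [k|u uvs].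
  by case: eqP => // _; exact: ltW.
rewrite big_cons eqxx.
have -> : \sum_(k <- es) (if k == i then t else y k) * u k = s u.
  rewrite /s !big_seq; apply: eq_bigr => k ke; case: eqP => // ki.
  by rewrite -ki ke in ies.
have [ui|ui|ui] := ltgtP (u i) 0.
- have /gt : s u / - u i \in [seq s w / - w i | w : {ffun S -> R} <- neg].
    by apply: map_f; rewrite mem_filter ui.
  by rewrite ltr_pdivlMr ?oppr_gt0 //; lra.
- have /lt : - s u / u i \in 0 :: [seq - s u / u i | u : {ffun S -> R} <- pos].
    rewrite inE; apply/orP; right.
    apply: (map_f (fun u : {ffun S -> R} => - s u / u i)).
    by rewrite mem_filter ui.
  by rewrite ltr_pdivrMr //; lra.
- rewrite ui mulr0 add0r; apply: ypos.
  by rewrite mem_cat mem_filter ui lexx uvs.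
Qed.

(** * Mixed strategies and saddle points *)

(** The alternative is applied to the columns [u i j - v]: a nonpositive combination of them
    normalises to [delta], while a [y] positive on every column contradicts the best response to
    [y]. *)
Lemma exists_mixed_strategy (R : realType) (I J : finType) (u : I -> J -> R) (v : R) :
  (forall y : I -> R, (forall i, 0 <= y i) ->
     exists j, \sum_i y i * u i j <= v * \sum_i y i) ->
  exists2 delta : {ffun J -> R}, is_distribution delta &
    forall i, \sum_j delta j * u i j <= v.
Proof.
move=> response.
pose col j := [ffun i => u i j - v].
(* The positive total of the coefficients is what permits normalisation. *)
pose K (w : {ffun I -> R}) := exists a : J -> R,
  [/\ forall j, 0 <= a j, 0 < \sum_j a j & forall i, w i = \sum_j a j * (u i j - v)].
have [||| [w [[a [a0 apos wE]] w0]]|[y [y0 ypos]]] :=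
  @cone_alternative R I (enum I) K [seq col j | j <- enum J].
- exact: enum_uniq.
- move=> a b w1 w2 a0 b0 [f [f0 fpos fE]] [g [g0 gpos gE]].
  exists (fun j => a * f j + b * g j); split=> [j||i].
  + by rewrite addr_ge0 // mulr_ge0 // ltW.
  + by rewrite big_split -!mulr_sumr /=; nra.
  + rewrite ffunE fE gE !mulr_sumr -big_split; apply: eq_bigr => j _ /=.
    by ring.
- move=> w /mapP[j _ ->]; exists (fun k => (k == j)%:R); split=> [k||i].
  + exact: ler0n.
  + by rewrite (bigD1 j) //= eqxx big1 ?addr0 // => k /negPf->.
  + rewrite ffunE (bigD1 j) //= eqxx mul1r big1 ?addr0 // => k /negPf->.
    by rewrite mul0r.
- exists [ffun j => a j / \sum_k a k].
    split=> [j|]; first by rewrite ffunE divr_ge0 // ltW.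
    under eq_bigr do rewrite ffunE.
    by rewrite -mulr_suml divff // gt_eqF.
  move=> i; under eq_bigr do rewrite ffunE mulrAC.
  rewrite -mulr_suml ler_pdivrMr //.
  have := w0 i; rewrite mem_enum wE => /(_ isT).
  under eq_bigr do rewrite mulrBr.
  by rewrite sumrB -mulr_suml subr_le0 mulrC.
have [j] := response y y0.
have := ypos (col j); rewrite map_f ?mem_enum // big_enum /= => /(_ isT).
under eq_bigr do rewrite ffunE mulrBr.
by rewrite sumrB -mulr_suml; lra.
Qed.

(** In any other equilibrium, the deviations to [delta] and to [sigma] bound the payoff by [v] from
    above and from below. *)
Lemma saddle_point_game_value (R : realType) (I J : finType) (u : I -> J -> R) (v : R)
    (sigma : {ffun I -> R}) (delta : {ffun J -> R}) :
  is_distribution sigma -> is_distribution delta ->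
  (forall j, v <= \sum_i sigma i * u i j) ->
  (forall i, \sum_j delta j * u i j <= v) ->
  is_game_value u v.
Proof.
move=> ds dd low up.
have lowE delta' : is_distribution delta' -> v <= expected_payoff u sigma delta'.
  case=> d0 d1; rewrite /expected_payoff exchange_big /= -[v]mul1r -d1 mulr_suml.
  apply: ler_sum => j _; rewrite (eq_bigr (fun i => delta' j * (sigma i * u i j))).
    by rewrite -mulr_sumr ler_wpM2l.
  by move=> i _; ring.
have upE sigma' : is_distribution sigma' -> expected_payoff u sigma' delta <= v.
  case=> s0 s1; rewrite /expected_payoff -[v]mul1r -s1 mulr_suml.
  apply: ler_sum => i _; rewrite (eq_bigr (fun j => sigma' i * (delta j * u i j))).
    by rewrite -mulr_sumr ler_wpM2l.
  by move=> j _; ring.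
have vE : expected_payoff u sigma delta = v.
  by apply/eqP; rewrite eq_le upE ?lowE.
split; first exists sigma, delta; rewrite ?vE //.
  by split=> //; split=> // x dx; rewrite vE ?upE ?lowE.
move=> s' d' [ds' dd' smax dmin]; apply/eqP; rewrite eq_le.
by rewrite (le_trans (dmin _ dd) (upE _ ds')) (le_trans (lowE _ dd') (smax _ ds)).
Qed.

(** * Rank and bases of a greedoid *)

Section Rank.
Variables (S : finType) (G : greedoid S).
Implicit Types (A B X Y : {set S}) (x : S).

Lemma rank_sup A X : X \in G -> X \subset A -> (#|X| <= rank G A)%N.
Proof. by move=> XG XA; apply: leq_bigmax_cond; rewrite XG. Qed.

Lemma rank_leP A m :
  reflect (forall X, X \in G -> X \subset A -> (#|X| <= m)%N) (rank G A <= m)%N.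
Proof.
apply: (iffP (bigmax_leqP _ _ _)) => h X; first by move=> XG XA; rewrite h ?XG.
by case/andP; apply: h.
Qed.

Lemma rank_witness A : exists X, [/\ X \in G, X \subset A & #|X| = rank G A].
Proof.
have P0 : (set0 \in G) && (set0 \subset A) by rewrite feasible0 sub0set.
rewrite /rank (bigop.bigmax_eq_arg set0) //; case: arg_maxnP => //= X /andP[XG XA] _.
by exists X.
Qed.

Lemma rank_subset A B : A \subset B -> (rank G A <= rank G B)%N.
Proof.
by move=> AB; apply/rank_leP => X XG XA; rewrite rank_sup // (subset_trans XA).
Qed.

Lemma is_baseE B : is_base G B = (B \in G) && (#|B| == rank G setT).
Proof.
apply/idP/idP => /andP[BG].
  move=> /'forall_implyP Bmax; rewrite BG eqn_leq rank_sup ?subsetT //=.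
  by apply/rank_leP => X XG _; apply: Bmax.
move=> /eqP cB; rewrite /is_base BG; apply/'forall_implyP => X XG.
by rewrite cB rank_sup ?subsetT.
Qed.

(** A maximal feasible [Y] with [A \subset Y \proper X] can be augmented from [X], and by maximality
    the result is [X] itself. *)
Lemma feasible_remove A X : A \in G -> X \in G -> A \proper X ->
  exists2 x, x \in X :\: A & X :\ x \in G.
Proof.
move=> AG XG AX.
have : exists Y, [&& Y \in G, A \subset Y & Y \proper X] by exists A; rewrite AG subxx.
case/ex_maxset => Y /maxsetP[/and3P[YG AY YX] Ymax].
have [y /setDP[yX yY] yYG] := feasible_aug YG XG (proper_card YX).
have AyY : A \subset y |: Y by rewrite (subset_trans AY) ?subsetU1.
have yYX : y |: Y \subset X by rewrite subUset sub1set yX proper_sub.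
have eX : y |: Y = X.
  apply/eqP; rewrite eqEsubset yYX /=; apply: contraNT yY => XyY.
  rewrite -(Ymax (y |: Y)) ?subsetU1 ?setU11 //.
  by rewrite yYG AyY properE yYX.
exists y; first by rewrite inE yX (contra _ yY) //; exact: (subsetP AY).
by rewrite -eX setU1K.
Qed.

End Rank.

(** * Paths and shadows in a local forest greedoid *)

Section LocalForest.
Variables (S : finType) (G : greedoid S) (lfG : local_forest_greedoid G).
Implicit Types (A B X Y : {set S}) (b s x : S).

Lemma feasibleU B X Y : B \in G -> X \in G -> Y \in G ->
  X \subset B -> Y \subset B -> X :|: Y \in G.
Proof.
case: lfG => U _ _ BG XG YG XB YB; apply: U => //.
by apply/'exists_andP; exists B; rewrite BG subUset XB YB.
Qed.

Lemma feasibleI B X Y : B \in G -> X \in G -> Y \in G ->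
  X \subset B -> Y \subset B -> X :&: Y \in G.
Proof.
case: lfG => _ I _ BG XG YG XB YB; apply: I => //.
by apply/'exists_andP; exists B; rewrite BG subUset XB YB.
Qed.

Lemma feasible_bigcup (I : finType) (P : pred I) B (F : I -> {set S}) : B \in G ->
  (forall i, P i -> F i \in G /\ F i \subset B) ->
  \bigcup_(i | P i) F i \in G.
Proof.
move=> BG FB.
  suff [] : \bigcup_(i | P i) F i \in G /\ \bigcup_(i | P i) F i \subset B by [].
elim/big_ind: _ => [|X Y [XG XB] [YG YB]|//]; first by rewrite feasible0 sub0set.
by rewrite subUset XB YB (feasibleU BG).
Qed.

Lemma feasible_bigcap (I : finType) (P : pred I) B (F : I -> {set S}) : B \in G ->
  (forall i, P i -> F i \in G /\ F i \subset B) ->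
  B :&: \bigcap_(i | P i) F i \in G.
Proof.
move=> BG FB; elim/big_rec: _ => [|i X /FB[FG FiB] BX]; first by rewrite setIT.
by rewrite setICA (feasibleI BG) ?subsetIl.
Qed.

(* The path of [b] in [A]: the least feasible subset of [A] containing [b].
   It is locked to keep [inE] from unfolding it. *)
Definition stem A b :=
  locked (A :&: \bigcap_(X in [set X in G | (X \subset A) && (b \in X)]) X).

Lemma stemE A b :
  stem A b = A :&: \bigcap_(X in [set X in G | (X \subset A) && (b \in X)]) X.
Proof. by rewrite /stem -lock. Qed.

Lemma stem_feasible A b : A \in G -> stem A b \in G.
Proof.
move=> AG; rewrite stemE; apply: feasible_bigcap => // X.
by rewrite inE => /and3P[].
Qed.

Lemma stem_sub A b : stem A b \subset A.
Proof. by rewrite stemE subsetIl. Qed.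

Lemma mem_stem A b : b \in A -> b \in stem A b.
Proof.
by move=> bA; rewrite stemE in_setI bA; apply/bigcapP => X; rewrite inE => /and3P[].
Qed.

Lemma stem_min A b X : X \in G -> X \subset A -> b \in X -> stem A b \subset X.
Proof.
move=> XG XA bX; rewrite stemE; apply: subIset.
by rewrite bigcap_inf ?orbT // inE XG XA.
Qed.

(** [A] competes in the minimum defining [stem B b], so that path already lies in [A]. Hence paths
    do not change while the feasible set grows. *)
Lemma stem_restrict A B b : A \in G -> B \in G -> A \subset B -> b \in A ->
  stem B b = stem A b.
Proof.
move=> AG BG AB bA; have bB := subsetP AB _ bA.
have sA : stem B b \subset A by apply: stem_min.
apply/eqP; rewrite eqEsubset.
apply/andP; split; apply: stem_min; rewrite ?stem_feasible ?mem_stem //.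
exact: subset_trans (stem_sub _ _) AB.
Qed.

(* The local forest property enters only here. *)
Lemma stem_pred A b : A \in G -> b \in A ->
  stem A b = [set b] \/ exists2 a, a \in A :\ b & stem A b = b |: stem A a.
Proof.
move=> AG bA; set P := stem A b.
have PG : P \in G by apply: stem_feasible.
have PA : P \subset A by apply: stem_sub.
have bP : b \in P by apply: mem_stem.
have Pmin X : X \in G -> X \subset P -> b \in X -> P = X.
  move=> XG XP bX; apply/eqP; rewrite eqEsubset XP andbT.
  by apply: stem_min; rewrite // (subset_trans XP).
have removal X x : X \in G -> X \subset P -> b \in X -> x \in P -> x \notin X -> False.
  by move=> XG XP bX xP; rewrite -(Pmin X) ?xP.
clearbody P.
have acc X : X \in G -> X != set0 -> exists2 x, x \in X & X :\ x \in G.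
  move=> XG X0; have [||x] := @feasible_remove _ G set0 X _ XG.
  - exact: feasible0.
  - by rewrite proper0.
  - by rewrite setD0; exists x.
(* Some element of [P] can be removed; by minimality of [P] it can only be [b]. *)
have QG : P :\ b \in G.
  have [|x xP xPG] := acc P PG; first by apply/set0Pn; exists b.
  have [->//|bx] := eqVneq b x; case: (removal (P :\ x) x) => //.
  - exact: subD1set.
  - by rewrite !inE bx.
  - by rewrite setD11.
have [Q0|Qn0] := eqVneq (P :\ b) set0.
  by left; rewrite -(setD1K bP) Q0 setU0.
have [a aQ aQG] := acc _ QG Qn0; right; exists a.
  by move: aQ; rewrite !inE => /andP[-> /(subsetP PA)].
have aA : a \in A by move: aQ; rewrite !inE => /andP[_ /(subsetP PA)].
rewrite -[LHS](setD1K bP); congr (_ |: _); apply/eqP; rewrite eqEsubset.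
have QA : P :\ b \subset A by rewrite (subset_trans (subD1set _ _)).
have sQ : stem A a \subset P :\ b by apply: stem_min.
(* Otherwise both [a] and some [y != a] can be removed from [P :\ b]. The local forest property at
   [C] then makes [P :\ y] or [P :\ a] feasible, against the minimality of [P]. *)
rewrite sQ andbT; apply: contraT => Qs.
have [||y] := @feasible_remove _ G (stem A a) (P :\ b) _ QG.
- exact: stem_feasible.
- by rewrite properE sQ.
move=> /setDP[yQ ys] yQG.
have ya : y != a by apply: contraNneq ys => ->; exact: mem_stem.
pose C := (P :\ b :\ a) :&: (P :\ b :\ y).
have CG : C \in G by apply: (feasibleI QG) => //; exact: subD1set.
move: (aQ) (yQ); rewrite !in_setD1 => /andP[ab aP] /andP[yb yP].
have bC x : b \in C :|: [set x; b] by rewrite !inE eqxx !orbT.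
have [_ _ /(_ C a y b CG)] := lfG; case.
- suff -> : a |: C = P :\ b :\ y by [].
  apply/setP => x; rewrite !inE; case: (eqVneq x a) => [->|_].
    by rewrite [a == y]eq_sym ya ab aP.
  by case: (x == y); case: (x == b); case: (x \in P).
- suff -> : y |: C = P :\ b :\ a by [].
  apply/setP => x; rewrite !inE; case: (eqVneq x y) => [->|_].
    by rewrite ya yb yP.
  by case: (x == a); case: (x == b); case: (x \in P).
- suff -> : C :|: [set a; y] = P :\ b by [].
  apply/setP => x; rewrite !inE.
  case: (eqVneq x a) => [->|]; first by rewrite ab aP ?orbT ?andbF.
  case: (eqVneq x y) => [->|]; first by rewrite yb yP ?orbT ?andbF.
  by rewrite !orbF !andTb andbb.
- suff -> : C :|: [set a; y; b] = P by [].
  apply/setP => x; rewrite !inE.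
  case: (eqVneq x a) => [->|]; first by rewrite aP ?orbT.
  case: (eqVneq x y) => [->|]; first by rewrite yP ?orbT.
  case: (eqVneq x b) => [->|]; first by rewrite bP ?orbT.
  by rewrite !orbF !andTb andbb.
- move=> XG; case: (removal _ y XG) => //.
    apply/subsetP => x; rewrite !inE; case/or3P=> [/andP[/and3P[]]|/eqP->|/eqP->] //.
  by rewrite !inE eqxx (negPf ya) (negPf yb) ?andbF.
- move=> XG; case: (removal _ a XG) => //.
    apply/subsetP => x; rewrite !inE; case/or3P=> [/andP[/and3P[]]|/eqP->|/eqP->] //.
  by rewrite !inE eqxx [a == y]eq_sym (negPf ya) (negPf ab) ?andbF.
Qed.

(** The elements whose paths avoid [U] form a union of paths, hence a feasible set. Conversely, a
    feasible subset of [A :\: U] contains the paths of its elements. *)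
Lemma rank_setD A U : A \in G ->
  rank G (A :\: U) = #|[set b in A | [disjoint U & stem A b]]|.
Proof.
move=> AG; set N := [set b in A | _].
have NE : N = \bigcup_(b in N) stem A b.
  apply/setP => b; apply/idP/bigcupP => [bN|[c]].
    by exists b => //; apply: mem_stem; move: bN; rewrite inE => /andP[].
  rewrite !inE => /andP[cA cU] bc; have bA := subsetP (stem_sub _ _) _ bc.
  rewrite bA; apply: disjointWr cU; apply: stem_min => //.
    exact: stem_feasible.
  exact: stem_sub.
have NG : N \in G.
  by rewrite NE; apply: (feasible_bigcup AG) => b _; rewrite stem_feasible ?stem_sub.
apply/eqP; rewrite eqn_leq rank_sup ?andbT //.
  apply/rank_leP => X XG XAU; apply: subset_leq_card; apply/subsetP => b bX.
  move: XAU; rewrite subsetD => /andP[XA XU].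
  rewrite inE (subsetP XA) //= disjoint_sym; apply: disjointWl XU.
  exact: stem_min.
apply/subsetP => b; rewrite !inE => /andP[bA bU]; rewrite bA andbT.
by apply: contraTN bU => bU; apply/pred0Pn; exists b; rewrite /= bU mem_stem.
Qed.

Lemma shadow_stem A x : A \in G -> shadow G A x = #|[set b in A | x \in stem A b]|.
Proof.
move=> AG; rewrite /shadow rank_setD // -cardsDS; last first.
  by apply/subsetP => b; rewrite inE => /andP[].
apply: eq_card => b; rewrite !inE disjoints1.
by case: (b \in A); rewrite ?andbF //= andbT negbK.
Qed.

Lemma shadow_sum (R : pzSemiRingType) (z : S -> R) A : A \in G ->
  \sum_x z x * (shadow G A x)%:R = \sum_(b in A) \sum_(x in stem A b) z x.
Proof.
move=> AG; rewrite [RHS](exchange_big_dep predT) //=; apply: eq_bigr => x _.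
rewrite shadow_stem // -sumr_const mulr_sumr; apply: eq_big => [b|b _].
  by rewrite inE.
by rewrite mulr1.
Qed.

(** Each [b] in [A] has a path that avoids [U], and is counted by the rank, or meets [U] in some
    [s], and is counted by the shadow of [s]. *)
Lemma card_le_rankD_shadow A U : A \in G ->
  (#|A| <= rank G (A :\: U) + \sum_(s in U) shadow G A s)%N.
Proof.
move=> AG; rewrite rank_setD //.
under eq_bigr do rewrite shadow_stem // -sum1_card.
rewrite (exchange_big_dep (mem A)) /=; last by move=> s b _; rewrite inE => /andP[].
rewrite -!sum1_card (bigID (fun b => [disjoint U & stem A b])) /= leq_add //.
  by rewrite leq_eqVlt; apply/orP; left; apply/eqP/eq_bigl => b; rewrite inE.
rewrite [leqRHS](bigID (fun b => [disjoint U & stem A b])) /=.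
apply: leq_trans (leq_addl _ _); apply: leq_sum => b.
case/andP=> bA /pred0Pn[s /andP[/= sU sb]].
by rewrite (bigD1 s) //= sU inE bA.
Qed.

Definition extensions A := [set s | (s \notin A) && (s |: A \in G)].

(** A larger feasible set would augment [A] by one of its own elements, which would then lie in
    [extensions A]. *)
Lemma rank_setC_extensions A : A \in G -> (rank G (setT :\: extensions A) <= #|A|)%N.
Proof.
move=> AG; apply/rank_leP => X XG; rewrite subsetD => /andP[_ XE].
rewrite leqNgt; apply/negP => /(feasible_aug AG XG)[x /setDP[xX xA] xAG].
by case/pred0Pn: XE; exists x; rewrite /= xX inE xA.
Qed.

(** * Dijkstra's algorithm with a dual packing of cuts *)

Section Greedy.
Variables (R : realFieldType) (z w : S -> R).
Hypotheses (z_ge0 : forall s, 0 <= z s) (w_ge0 : forall s, 0 <= w s).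
Hypothesis w_cut : forall U : {set S},
  (rank G setT)%:R - (rank G (setT :\: U))%:R <= \sum_(s in U) w s.
Implicit Types (T : R) (l : S -> R).

Definition dist A b := \sum_(x in stem A b) z x.

Lemma sum_subset X Y : X \subset Y -> \sum_(x in X) z x <= \sum_(x in Y) z x.
Proof.
move=> XY; rewrite big_mkcond [leRHS]big_mkcond; apply: ler_sum => x _.
by case: ifP => [/(subsetP XY)->//|_]; case: ifP.
Qed.

Lemma dist_pred A b : A \in G -> b \in A ->
  dist A b <= z b \/ exists2 a, a \in A :\ b & dist A b <= z b + dist A a.
Proof.
move=> AG bA; rewrite /dist; case: (stem_pred AG bA) => [->|[a aA ->]].
  by left; rewrite big_set1.
right; exists a => //.
have [ba|ba] := boolP (b \in stem A a); last by rewrite big_setU1.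
by rewrite (setUidPr _) ?sub1set // lerDr.
Qed.

(* [l s] is the total weight of the cuts [extensions A'] containing [s], over the
   sets [A'] visited before [A]; [T] is the distance of the last element added. *)
Record greedy_state A T l : Prop := GreedyState {
  state_feasible : A \in G;
  state_time : 0 <= T;
  state_load : forall s, l s <= z s;
  state_cost : \sum_(b in A) dist A b + ((rank G setT)%:R - #|A|%:R) * T
                 <= \sum_s l s * w s;
  state_reached : {in A, forall b, dist A b <= T};
  state_unreached : {in extensions A, forall s, T <= dist (s |: A) s};
  state_slack : {in extensions A, forall s, l s + dist (s |: A) s <= T + z s};
  state_support : forall s,
    l s <= 0 \/ exists2 A' : {set S}, A' \subset A & s |: A' \in G
}.

Lemma greedy_state0 : greedy_state set0 0 (fun=> 0).
Proof.
split=> //.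
- exact: feasible0.
- by rewrite big_set0 mulr0 addr0 big1 // => s _; rewrite mul0r.
- by move=> s; rewrite inE.
- by move=> s _; apply: sumr_ge0.
- move=> s; rewrite inE setU0 => /andP[_ sG].
  rewrite !add0r -[leRHS](big_set1 +%R s z) sum_subset //.
  by apply: stem_min; rewrite ?set11.
- by move=> s; left.
Qed.

Lemma dist_extend A A' s : s |: A \in G -> s |: A' \in G -> A \subset A' ->
  dist (s |: A') s = dist (s |: A) s.
Proof.
by move=> sA sA' AA'; rewrite /dist (@stem_restrict (s |: A)) ?setUS ?setU11.
Qed.

(** The closest extension [b] is added, the time moves to its distance [T'], and the cut
    [extensions A] receives weight [T' - T]. In [state_cost] each element still to be added is
    charged the current time. *)
Lemma greedy_step A T l : greedy_state A T l -> (#|A| < rank G setT)%N ->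
  exists b T' l', b \notin A /\ greedy_state (b |: A) T' l'.
Proof.
case=> AG T0 lz cost reached unreached slack support Ar.
have [b0 b0E] : exists b0, b0 \in extensions A.
  have [Y [YG _ cY]] := rank_witness G setT.
  have [|y /setDP[_ yA] yAG] := feasible_aug AG YG; first by rewrite cY.
  by exists y; rewrite inE yA.
have [b bE bmin] : exists2 b, b \in extensions A &
    forall s, s \in extensions A -> dist (b |: A) b <= dist (s |: A) s.
  by case: (arg_minP (fun s => dist (s |: A) s) b0E) => b bE bmin; exists b.
set T' := dist (b |: A) b; have TT' : T <= T' by apply: unreached.
have /[!inE] /andP[bA bG] := bE.
have Ab : A \subset b |: A by apply: subsetUr.
have distA : {in A, forall x, dist (b |: A) x = dist A x}.
  by move=> x xA; rewrite /dist (@stem_restrict A).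
(* By local union, an extension of [b |: A] that also extended an earlier set extends [A]; so one
   that does not extend [A] carries no load yet. *)
have extE s A' : s \in extensions (b |: A) -> A' \subset A -> s |: A' \in G ->
    s \in extensions A.
  rewrite !inE negb_or => /andP[/andP[_ ->] sG] A'A sA' /=.
  have -> : s |: A = (s |: A') :|: A by rewrite -setUA (setUidPr A'A).
  apply: (feasibleU sG sA' AG); first by rewrite setUS // (subset_trans A'A).
  by rewrite (subset_trans Ab) ?subsetUr.
have cutA : (rank G setT)%:R - #|A|%:R <= \sum_(s in extensions A) w s.
  apply: le_trans (w_cut _); rewrite lerD2l lerN2 ler_nat.
  exact: rank_setC_extensions.
pose l' s := l s + (if s \in extensions A then T' - T else 0).
exists b, T', l'; split=> //; split=> //.
- exact: le_trans TT'.
- move=> s; rewrite /l'; case: ifP => sE; last by rewrite addr0.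
  by have := slack s sE; have := bmin s sE; rewrite -/T'; lra.
(* The left side grows by [T' - T] times [r(S) - #|A|], which [cutA] bounds by the growth of the
   right side. *)
- rewrite big_setU1 //= -/T' cardsU1 bA natrD /l'.
  rewrite (eq_bigr _ distA).
  under [leRHS]eq_bigr do rewrite mulrDl.
  rewrite big_split /=; set c := (X in _ <= _ + X).
  have -> : c = (T' - T) * \sum_(s in extensions A) w s.
    rewrite mulr_sumr [RHS]big_mkcond; apply: eq_bigr => s _.
    by case: ifP; rewrite ?mul0r.
  by nra.
- move=> x /setU1P[->//|xA]; rewrite distA //; exact: le_trans (reached _ xA) TT'.
- move=> s sE; have [sEA|sEA] := boolP (s \in extensions A).
    have /[!inE] /andP[_ sAG] := sEA; have /[!inE] /andP[_ sG] := sE.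
    by rewrite (dist_extend sAG sG Ab); apply: bmin.
  have /[!inE] /andP[+ sG] := sE; rewrite negb_or => /andP[sb sA].
  (* If the path of [s] avoided [b], its union with [A] would make [s] an extension of [A]. So it
     contains the path of [b], of length [T']. *)
  have bs : b \in stem (s |: (b |: A)) s.
    apply: contraNT sEA => bs; rewrite inE sA.
    have -> : s |: A = stem (s |: (b |: A)) s :|: A.
      apply/eqP; rewrite eqEsubset subUset sub1set in_setU mem_stem ?setU11 //=.
      rewrite subsetUr subUset subsetUr andbT.
      apply/subsetP => x xs; have := subsetP (stem_sub _ _) _ xs.
      rewrite !inE => /or3P[->//|/eqP xb|->]; last by rewrite orbT.
      by rewrite xb (negPf bs) in xs.
    apply: (feasibleU sG) => //; rewrite ?stem_feasible ?stem_sub //.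
    by rewrite (subset_trans Ab) ?subsetUr.
  rewrite /T' /dist -(@stem_restrict (b |: A) (s |: (b |: A))) ?subsetUr ?setU11 //.
  by apply: sum_subset; apply: stem_min; rewrite ?stem_feasible ?stem_sub.
- move=> s sE; have /[!inE] /andP[+ sG] := sE; rewrite negb_or => /andP[sb sA].
  rewrite /l'.
  case: (boolP (s \in extensions A)) => sEA.
    have /[!inE] /andP[_ sAG] := sEA.
    by rewrite (dist_extend sAG sG Ab) /=; have := slack s sEA; lra.
  (* For a new extension the load is at most 0, and its path is at most [z s] longer than a path in
     [b |: A], of length at most [T']. *)
  rewrite /=; have ls : l s <= 0.
    by case: (support s) => // -[A' A'A sA']; rewrite (extE s A') in sEA.
  have T'0 : 0 <= T' by apply: le_trans TT'.
  case: (dist_pred sG (setU11 _ _)) => [|[a]]; first by lra.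
  have sbA : s \notin b |: A by rewrite in_setU1 negb_or sb.
  rewrite (setU1K sbA) => aA.
  suff : dist (s |: (b |: A)) a <= T' by lra.
  rewrite /dist (@stem_restrict (b |: A)) ?subsetUr // -/(dist _ _).
  move: aA => /setU1P[->//|aA]; rewrite distA //; exact: le_trans (reached _ aA) TT'.
- move=> s; rewrite /l'; case: ifPn => [sE|_].
    by right; exists A => //; move: sE; rewrite inE => /andP[].
  rewrite addr0; case: (support s) => [|[A' A'A sA']]; first by left.
  by right; exists A' => //; apply: subset_trans Ab.
Qed.

(** At full rank the pending term of [state_cost] vanishes, and [l <= z] with [w >= 0] bounds the
    value of the packing. *)
Lemma greedy_base : exists2 B, is_base G B &
  \sum_s z s * (shadow G B s)%:R <= \sum_s z s * w s.
Proof.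
have [A [T [l [st cA]]]] : exists A T l, greedy_state A T l /\ #|A| = rank G setT.
  suff /(_ _ (leqnn _)) : forall n, (n <= rank G setT)%N ->
    exists A T l, greedy_state A T l /\ #|A| = n by [].
  elim=> [|n IHn] nr.
    by exists set0, 0, (fun=> 0); split; [exact: greedy_state0|rewrite cards0].
  have [A [T [l [st cA]]]] := IHn (ltnW nr).
  have [|b [T' [l' [bA st']]]] := greedy_step st; first by rewrite cA.
  by exists (b |: A), T', l'; rewrite cardsU1 bA cA.
have AG := state_feasible st.
exists A; first by rewrite is_baseE AG cA eqxx.
rewrite shadow_sum //; have := state_cost st.
rewrite cA subrr mul0r addr0 => /le_trans; apply; apply: ler_sum => s _.
by rewrite ler_wpM2r // (state_load st).
Qed.

End Greedy.

End LocalForest.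

(** * The value of the game *)

Theorem theorem12 (R : realType) (S : finType) (G : greedoid S) (d c : S -> R)
    (hS : (0 < #|S|)%N) (hG : local_forest_greedoid G)
    (hd : forall s, 0 < d s) :
  let p (s : S) := 1 / d s in
  let q (s : S) := c s / d s in
  let ratio (U : {set S}) :=
    ((rank G [set: S])%:R - (rank G ([set: S] :\: U))%:R - \sum_(s in U) q s)
      / \sum_(s in U) p s in
  (* U = [set: S] is itself in the range, so the default value of the
     maximum adds nothing *)
  is_game_value (lfg_payoff G d c)
    (\big[Num.max/ratio [set: S]]_(U : {set S} | U != set0) ratio U).
Proof.
move=> p q ratio; set v := \big[_/_]_(_ | _) _.
have d_neq0 s : d s != 0 by rewrite gt_eqF.
have p_gt0 (U : {set S}) : U != set0 -> 0 < \sum_(s in U) p s.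
  case/set0Pn=> s sU; rewrite (bigD1 s) //= ltr_pwDl ?divr_gt0 //.
  by apply: sumr_ge0 => t _; rewrite divr_ge0 ?ltW.
have [U0 U0n vE] : exists2 U0, U0 != set0 & v = ratio U0.
  rewrite /v; elim/big_rec: _ => [|U x Un [V Vn ->]].
    by exists setT; rewrite // -cards_eq0 cardsT -lt0n.
  by rewrite /Num.max; case: ifP => _; [exists V|exists U].
have v_max U : U != set0 -> ratio U <= v by move=> Un; apply: le_bigmax_cond.
pose w s := q s + v * p s.
have w_cut (U : {set S}) :
    (rank G setT)%:R - (rank G (setT :\: U))%:R <= \sum_(s in U) w s.
  have [->|Un] := eqVneq U set0; first by rewrite setD0 subrr big_set0.
  have -> : \sum_(s in U) w s = \sum_(s in U) q s + v * \sum_(s in U) p s.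
    by rewrite mulr_sumr -big_split.
  by have := v_max U Un; rewrite ler_pdivrMr ?p_gt0 //; lra.
have w_ge0 s : 0 <= w s.
  rewrite -[w s](big_set1 +%R s w); apply: le_trans (w_cut _).
  by rewrite subr_ge0 ler_nat rank_subset ?subsetT.
have [y y0|delta ddelta delta_le] := @exists_mixed_strategy R _ _ (lfg_payoff G d c) v.
  (* With [z = y * d], the product [z * w] equals [y * c + v * y], so the greedy bound becomes the
     response inequality. *)
  have z_ge0 s : 0 <= y s * d s by rewrite mulr_ge0 // ltW.
  have [B Bb Bw] := greedy_base hG z_ge0 w_ge0 w_cut.
  exists (exist _ B Bb); rewrite /lfg_payoff /=.
  under eq_bigr do rewrite mulrBr mulrA.
  rewrite sumrB lerBlDr (le_trans Bw) // mulr_sumr -big_split /=.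
  rewrite le_eqVlt; apply/orP; left; apply/eqP/eq_bigr => s _.
  by rewrite /w /p /q; field.
pose sigma := [ffun s => if s \in U0 then p s / \sum_(t in U0) p t else 0].
have U0p := p_gt0 _ U0n.
apply: (@saddle_point_game_value _ _ _ _ _ sigma delta) => //.
  split=> [s|].
    by rewrite ffunE; case: ifP => // _; rewrite !divr_ge0 ?ltW.
  under eq_bigr do rewrite ffunE.
  by rewrite -big_mkcond -mulr_suml divff // gt_eqF.
case=> B Bb; rewrite /lfg_payoff /= vE /ratio.
(* The weights [p] cancel the factors [d], leaving the plain sum of shadows over [U0]. *)
have -> : \sum_s sigma s * (d s * (shadow G B s)%:R - c s) =
    (\sum_(s in U0) (shadow G B s)%:R - \sum_(s in U0) q s) / \sum_(s in U0) p s.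
  rewrite -sumrB mulr_suml [RHS]big_mkcond; apply: eq_bigr => s _.
  rewrite ffunE; case: ifP => _; last by rewrite mul0r.
  by rewrite /p /q; field; rewrite d_neq0 gt_eqF.
rewrite ler_pM2r ?invr_gt0 // lerD2r lerBlDl -natr_sum -natrD ler_nat.
move: Bb; rewrite is_baseE => /andP[BG /eqP <-].
apply: leq_trans (card_le_rankD_shadow hG U0 BG) _.
by rewrite leq_add2r rank_subset // setSD ?subsetT.
Qed.
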